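(* For every generalised multi-clause-set $F$ we have $\delta(F)\le\mathrm{hdef}(F)$.
   Context: Each variable $v$ has a finite non-empty domain $D_v$; a literal is a pair $(v,\varepsilon)$, $\varepsilon\in D_v$, meaning ''$v\ne\varepsilon$''; a clause is a finite set of literals with no two distinct literals on the same variable; a multi-clause-set is a finitely supported map from clauses to $\mathbb{N}_0$ (a finite list of clause occurrences). $c(F)$ = number of clause occurrences, $\mathrm{rd}(F)=\sum_{v\in\mathrm{var}(F)}(|D_v|-1)$, $\delta(F)=c(F)-\mathrm{rd}(F)$. The conflict matrix $\mathrm{CM}(F)$ is the symmetric $c(F)\times c(F)$ matrix indexed by clause occurrences whose $(i,j)$ entry is the number of variables $v$ on which occurrences $i$ and $j$ contain literals $(v,\varepsilon)$, $(v,\varepsilon')$ with $\varepsilon\ne\varepsilon'$ (diagonal entries $0$). The hermitian rank $h(M)$ of a real symmetric matrix $M$ is the maximum of its number of positive and its number of negative eigenvalues (with multiplicity); $\mathrm{hdef}(F):=c(F)-h(\mathrm{CM}(F))$. *)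

(* Defs.v *)
From HB Require Import structures.
From mathcomp Require Import all_boot all_order all_algebra.
From mathcomp Require Import finmap multiset polyrcf reals.

Set Implicit Arguments.
Unset Strict Implicit.
Unset Printing Implicit Defensive.

Import Order.TTheory GRing.Theory Num.Theory.
Local Open Scope fset_scope.
Local Open Scope ring_scope.

Section GeneralisedClauses.

Variables (V : choiceType) (D : V -> finType).

(* [Tagged D e], for e : D v, is the literal "v != e". *)
Definition literal : choiceType := {v : V & D v}.

Definition clause_axiom (L : {fset literal}) : bool :=
  [forall x : L, forall y : L, (tag (val x) == tag (val y)) ==> (x == y)].

Record clause := Clause {
  clause_lits :> {fset literal};
  _ : clause_axiom clause_lits
}.

HB.instance Definition _ := [isSub for clause_lits].
HB.instance Definition _ := [Choice of clause by <:].

Definition clause_var (C : clause) : {fset V} :=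
  [fset tag x | x in clause_lits C].

Definition conflict_var (C C' : clause) : {fset V} :=
  [fset v in clause_var C |
    [exists e : D v, exists e' : D v,
      [&& Tagged D e \in clause_lits C, Tagged D e' \in clause_lits C'
        & e != e']]].

(* The coercion of a multiset to [seq] lists each clause as often as its
   multiplicity, so positions in this list are the clause occurrences. *)
Definition multi_clause_set : Type := {mset clause}%mset.
Identity Coercion multi_clause_set_mset : multi_clause_set >-> multiset_of.

Implicit Type F : multi_clause_set.

Definition nclauses F : nat := size F.

Definition var F : {fset V} := \bigcup_(C <- F) clause_var C.

Definition rd F : nat := (\sum_(v <- var F) (#|D v| - 1))%N.

Definition deficiency F : int := (nclauses F)%:Z - (rd F)%:Z.

Definition clause_occ F (i : 'I_(nclauses F)) : clause := tnth (in_tuple F) i.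

Definition conflict_matrix (R : pzSemiRingType) F : 'M[R]_(nclauses F) :=
  \matrix_(i, j) #|` conflict_var (clause_occ i) (clause_occ j)|%:R.

End GeneralisedClauses.

Section HermitianRank.

Variables (R : rcfType) (n : nat).
Implicit Type M : 'M[R]_n.

(* [rootsR] lists each real root of the characteristic polynomial once;
   [mup] restores its multiplicity. *)
Definition num_pos_eigenvalues M : nat :=
  (\sum_(x <- rootsR (char_poly M) | (0 < x)%R) mup x (char_poly M))%N.

Definition num_neg_eigenvalues M : nat :=
  (\sum_(x <- rootsR (char_poly M) | (x < 0)%R) mup x (char_poly M))%N.

(* Only meaningful for symmetric M. *)
Definition hermitian_rank M : nat :=
  maxn (num_pos_eigenvalues M) (num_neg_eigenvalues M).

End HermitianRank.

Definition hermitian_defect (R : rcfType) (V : choiceType) (D : V -> finType)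
    (F : multi_clause_set D) : int :=
  (nclauses F)%:Z - (hermitian_rank (conflict_matrix R F))%:Z.

(* Main.v *)
(* It suffices to show h(CM(F)) <= rd(F). For a variable v write u_(v,e) for the
   indicator vector of the occurrences containing the literal (v,e), and s_v for
   the sum of the u_(v,e) over e. A clause has at most one literal on v, so the
   quadratic form of CM(F) is the sum over v of
     |<x,s_v>|^2 - sum_e |<x,u_(v,e)>|^2.
   It is nonpositive when x is orthogonal to every s_v with |D_v| > 1, and
   nonnegative when x is orthogonal to all the u_(v,e) but one for each v. Both
   are at most rd(F) linear conditions, whereas the span of the eigenvectors for
   the positive (resp. negative) eigenvalues meets such a subspace only in 0.
   The spectral theorem is available over algebraically closed fields, so
   everything is done over R[i]. *)
Require Import Defs.
From mathcomp Require Import all_boot all_order all_algebra.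
From mathcomp Require Import reals.
From mathcomp Require Import finmap multiset polyrcf complex.

Set Implicit Arguments.
Unset Strict Implicit.
Unset Printing Implicit Defensive.

Import Order.TTheory GRing.Theory Num.Theory.
Local Open Scope fset_scope.
Local Open Scope ring_scope.
Local Open Scope sesquilinear_scope.

Local Notation toC := (@real_complex_def _ (Phant _)).

(** * Counting eigenvalues through a unitary diagonalisation *)

Lemma mup_prod_XsubC_count (R : fieldType) (s : seq R) (x : R) :
  mup x (\prod_(y <- s) ('X - y%:P)) = count_mem x s.
Proof.
elim: s => [|y s IHs]; first by rewrite big_nil mupNroot // root1.
rewrite big_cons mupM ?polyXsubC_eq0 ?monic_neq0 ?monic_prod_XsubC //.
by rewrite IHs -['X - y%:P]expr1 mup_XsubCX /=; case: eqP.
Qed.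

(** The multiplicity of [x] in [p] is its number of occurrences in [s]; after exchanging the sums,
    each entry of [s] satisfying [Q] is counted exactly once, at the root equal to it. *)
Lemma sum_mup_rootsR (R : rcfType) (s : seq R) (Q : pred R) :
  let p := \prod_(y <- s) ('X - y%:P) in
  (\sum_(x <- rootsR p | Q x) mup x p)%N = count Q s.
Proof.
move=> p; have p_neq0 : p != 0 by rewrite monic_neq0 ?monic_prod_XsubC.
under eq_bigr do rewrite mup_prod_XsubC_count -sum1_count big_mkcond /=.
rewrite exchange_big -sum1_count [RHS]big_mkcond /=.
rewrite big_seq [RHS]big_seq; apply: eq_bigr => y ys.
have y_root : y \in rootsR p.
  by rewrite -(roots_on_rootsR p_neq0) /= root_prod_XsubC.
rewrite -big_mkcondr /= (big_rem y) //= eqxx andbT.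
rewrite big_seq_cond big1 ?addn0 // => x /and3P[+ _ /eqP yx].
by rewrite -yx mem_rem_uniq ?uniq_roots // inE eqxx.
Qed.

(** Over [R[i]] the matrix becomes hermitian, hence unitarily diagonalisable with real spectrum; the
    rows of [P] are left eigenvectors. *)
Lemma sym_spectral (R : rcfType) n (M : 'M[R]_n) : M^T = M ->
  exists (P : 'M[R[i]]_n) (r : 'I_n -> R), P \is unitarymx /\
    map_mx toC M = P^t* *m diag_mx (\row_i toC (r i)) *m P.
Proof.
move=> Msym; set A := map_mx _ M.
have Aherm : A \is hermsymmx.
  apply/realsym_hermsym.
    by apply/is_hermitianmxP; rewrite expr0 scale1r map_mx_id // map_trmx Msym.
  by apply/mxOverP => i j; rewrite mxE; apply/complex_realP; exists (M i j).
have /orthomx_spectralP := hermitian_normalmx Aherm.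
have := hermitian_spectral_diag_real Aherm.
have := spectral_unitarymx A.
move: (spectralmx A) (spectral_diag A) => P d Pu /mxOverP d_real AE.
exists P, (fun i => complex.Re (d 0 i)); split=> //.
have -> : \row_i toC (complex.Re (d 0 i)) = d.
  by apply/rowP => i; rewrite mxE RRe_real.
by rewrite -invmx_unitary.
Qed.

Lemma char_poly_conj (K : fieldType) n (P A : 'M[K]_n) : P \in unitmx ->
  char_poly (invmx P *m A *m P) = char_poly A.
Proof.
move=> Punit; rewrite /char_poly; set B := invmx P *m A *m P.
(* The similarity lifts to the characteristic matrices; determinants then agree after cancelling the
   nonzero factor from [P]. *)
have PB : map_mx polyC P *m char_poly_mx B = char_poly_mx A *m map_mx polyC P.
  rewrite /char_poly_mx mulmxBr mulmxBl scalar_mxC -!map_mxM.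
  by rewrite /B !mulmxA mulmxV // mul1mx.
have detP_neq0 : \det (map_mx polyC P) != 0.
  by rewrite det_map_mx polyC_eq0 -unitfE -unitmxE.
by apply: (mulfI detP_neq0); rewrite -det_mulmx PB det_mulmx mulrC.
Qed.

Lemma char_poly_spectral (R : rcfType) n (M : 'M[R]_n) (P : 'M[R[i]]_n)
    (r : 'I_n -> R) : P \is unitarymx ->
  map_mx toC M = P^t* *m diag_mx (\row_i toC (r i)) *m P ->
  char_poly M = \prod_(y <- [seq r i | i <- enum 'I_n]) ('X - y%:P).
Proof.
move=> Pu ME; apply: (map_inj_poly (@complexI R)) => //.
rewrite map_char_poly ME -invmx_unitary // big_map big_enum rmorph_prod /=.
rewrite char_poly_conj ?unitarymx_unit //.
rewrite char_poly_trig ?diag_mx_is_trig //; apply: eq_bigr => i _.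
by rewrite !mxE eqxx mulr1n rmorphB /= map_polyX map_polyC.
Qed.

(** * Linear conditions and the inertia bound *)

Lemma common_kernel_nonzero (K : fieldType) n (cs : seq 'cV[K]_n) :
  (size cs < n)%N ->
  exists2 y : 'rV[K]_n, y != 0 & {in cs, forall c, y *m c = 0}.
Proof.
(* The conditions are the columns of [A], whose rank is thus below [n], so its left kernel is
   nonzero. *)
move=> lt_cs; pose A := \matrix_(i < n, j < size cs) cs`_j i 0.
have kerN0 : kermx A != 0.
  rewrite -mxrank_eq0 mxrank_ker subn_eq0 -ltnNge.
  by rewrite (leq_ltn_trans (rank_leq_col _)).
have /rowV0Pn[y /sub_kermxP yA y_neq0] := kerN0.
exists y => // c /(nthP 0)[j lt_j <-].
move/rowP/(_ (Ordinal lt_j)): yA; rewrite !mxE => yA.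
apply/rowP => k; rewrite !mxE ord1 -[RHS]yA.
by apply: eq_bigr => i _; rewrite mxE.
Qed.

(** The rows of [P] are orthonormal, and the form is diagonal in the coordinates [y] with respect to
    them. *)
Lemma spectral_form (R : rcfType) n (P : 'M[R[i]]_n) (d y : 'rV[R[i]]_n) :
  P \is unitarymx ->
  ((y *m P) *m (P^t* *m diag_mx d *m P) *m (y *m P)^t*) 0 0 =
  \sum_i d 0 i * (y 0 i * (y 0 i)^*).
Proof.
move=> /unitarymxP PP.
rewrite trmx_mul map_mxM !mulmxA -[y *m P *m _]mulmxA PP mulmx1.
rewrite -[_ *m P *m _]mulmxA PP mulmx1 mul_mx_diag mxE.
by apply: eq_bigr => i _; rewrite !mxE mulrAC mulrC mulrA.
Qed.

(* The eigenvectors with [0 < eps * eigenvalue] span a space on which the form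
   is definite, so it meets the common kernel of [cs] only in 0. *)
Lemma inertia_bound (R : rcfType) n (M : 'M[R]_n) (eps : R)
    (cs : seq 'cV[R[i]]_n) : M^T = M ->
  (forall x : 'rV[R[i]]_n, {in cs, forall c, x *m c = 0} ->
     toC eps * (x *m map_mx toC M *m x^t*) 0 0 <= 0) ->
  (\sum_(x <- rootsR (char_poly M) | (0 < eps * x)%R) mup x (char_poly M)
     <= size cs)%N.
Proof.
move=> Msym form_le0; have [P [r [Pu ME]]] := sym_spectral Msym.
rewrite (char_poly_spectral Pu ME) sum_mup_rootsR count_map.
pose A := [set i | 0 < eps * r i].
rewrite -sum1_count big_enum_cond.
rewrite (eq_bigl (mem A)) => [|i]; last by rewrite !inE.
rewrite sum1_card.
rewrite leqNgt; apply/negP => lt_cs.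
(* In eigencoordinates: the first conditions put [y *m P] in the common kernel of [cs], the others
   kill every coordinate outside [A]. *)
pose cs' := [seq P *m c | c <- cs] ++ [seq delta_mx i 0 | i <- enum (~: A)].
have lt_cs' : (size cs' < n)%N.
  rewrite size_cat !size_map -cardE -[X in (_ < X)%N]card_ord -(cardsC A).
  by rewrite ltn_add2r.
have [y y_neq0 y_ker] := common_kernel_nonzero lt_cs'.
have yA i : i \notin A -> y 0 i = 0.
  move=> iA; have : delta_mx i 0 \in cs'.
    rewrite mem_cat; apply/orP; right; apply/mapP; exists i => //.
    by rewrite mem_enum in_setC.
  by move=> /y_ker/rowP/(_ 0); rewrite -colE !mxE.
have /form_le0 : {in cs, forall c, y *m P *m c = 0}.
  by move=> c cin; rewrite -mulmxA y_ker // mem_cat map_f.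
rewrite ME spectral_form // mulr_sumr.
have term_ge0 i : 0 <= toC eps * ((\row_i toC (r i)) 0 i * (y 0 i * (y 0 i)^*)).
  have [iA|/yA->] := boolP (i \in A); last by rewrite mul0r !mulr0.
  rewrite mulrA mulr_ge0 ?mul_conjC_ge0 // mxE -rmorphM /= ler0c ltW //.
  by rewrite inE in iA.
move=> sum_le0; move/rV0Pn: y_neq0 => [i yi].
have iA : i \in A by apply: contraNT yi => /yA ->.
have sum_eq0 :
    \sum_i toC eps * ((\row_i toC (r i)) 0 i * (y 0 i * (y 0 i)^*)) = 0.
  by apply/eqP; rewrite eq_le sum_le0 sumr_ge0.
(* A vanishing sum of nonnegative terms has only zero terms; as [y 0 i] is nonzero, this forces
   [eps * r i = 0], against [i \in A]. *)
have /(_ i isT)/eqP := psumr_eq0P (fun i _ => term_ge0 i) sum_eq0.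
rewrite mulrA mxE -rmorphM /= mulf_eq0 mul_conjC_eq0 (negPf yi) orbF.
rewrite -[0]/(toC 0) (inj_eq (@complexI R)) => /eqP eps_r.
by move: iA; rewrite inE eps_r ltxx.
Qed.

(** * The conflict matrix as a sum of rank-one matrices *)

Lemma clause_literal_inj (V : choiceType) (D : V -> finType) (C : clause D) v
    (e e' : D v) :
  Tagged D e \in clause_lits C -> Tagged D e' \in clause_lits C -> e = e'.
Proof.
case: C => L /= /forallP axL eL e'L.
have /forallP/(_ [` e'L])/implyP/(_ (eqxx _))/eqP := axL [` eL].
by move/(congr1 val)/eqP; rewrite eq_Tagged => /eqP.
Qed.

(** The vector [u_(v,e)]; the ring is a parameter because both [R] and [R[i]] occur. *)
Definition lit_vec (R : pzSemiRingType) (V : choiceType) (D : V -> finType)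
    (F : multi_clause_set D) (v : V) (e : D v) : 'cV[R]_(nclauses F) :=
  \col_i (Tagged D e \in clause_lits (clause_occ i))%:R.

Definition var_vec (R : pzSemiRingType) (V : choiceType) (D : V -> finType)
    (F : multi_clause_set D) (v : V) : 'cV[R]_(nclauses F) :=
  \sum_(e : D v) lit_vec R F e.

Lemma clause_var_sub (V : choiceType) (D : V -> finType)
    (F : multi_clause_set D) (i : 'I_(nclauses F)) :
  clause_var (clause_occ i) `<=` var F.
Proof.
by rewrite /var; apply: (bigfcup_sup _ (mem_tnth i (in_tuple F))).
Qed.

Lemma card_conflict_var (V : choiceType) (D : V -> finType)
    (F : multi_clause_set D) (i j : 'I_(nclauses F)) :
  #|` conflict_var (clause_occ i) (clause_occ j)| =
  (\sum_(v <- var F) (v \in conflict_var (clause_occ i) (clause_occ j)))%N.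
Proof.
set A := conflict_var _ _.
rewrite -big_mkcond sum1_count -size_filter; apply: perm_size.
apply: uniq_perm; rewrite ?filter_uniq ?fset_uniq // => v.
rewrite mem_filter andb_idr // => vA.
apply: (fsubsetP (clause_var_sub i)).
by move: vA; rewrite /A /conflict_var !inE => /andP[].
Qed.

(** Each factor of the product is 0 or 1 and tells whether the clause contains [v]; the last sum is
    1 exactly when both clauses contain the same literal on [v]. *)
Lemma conflict_var_indicator (R : pzRingType) (V : choiceType)
    (D : V -> finType) (C C' : clause D) (v : V) :
  (v \in conflict_var C C')%:R =
  (\sum_(e : D v) (Tagged D e \in clause_lits C)%:R) *
    (\sum_(e : D v) (Tagged D e \in clause_lits C')%:R) -
  \sum_(e : D v) (Tagged D e \in clause_lits C)%:R *
    (Tagged D e \in clause_lits C')%:R :> R.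
Proof.
have sum_lit (G : clause D) (e : D v) (g : D v -> R) :
    Tagged D e \in clause_lits G ->
    \sum_(e' : D v) (Tagged D e' \in clause_lits G)%:R * g e' = g e.
  move=> eG; rewrite (bigD1 e) //= eG mul1r big1 ?addr0 // => e' e'e.
  case e'G: (_ \in _); last by rewrite mul0r.
  by rewrite (clause_literal_inj e'G eG) eqxx in e'e.
have sum_lit1 (G : clause D) (e : D v) : Tagged D e \in clause_lits G ->
    \sum_(e' : D v) (Tagged D e' \in clause_lits G)%:R = 1 :> R.
  move=> eG; rewrite -[RHS](sum_lit G e (fun=> 1) eG).
  by apply: eq_bigr => e1 _; rewrite mulr1.
have conflictE : (v \in conflict_var C C') =
    [exists e : D v, exists e' : D v,
      [&& Tagged D e \in clause_lits C, Tagged D e' \in clause_lits C'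
        & e != e']].
  rewrite /conflict_var !inE andb_idl //.
  move=> /existsP[e /existsP[e' /and3P[eC _ _]]].
  by apply/imfsetP; exists (Tagged D e).
rewrite conflictE.
have [e eC|noC] := pickP (fun e : D v => Tagged D e \in clause_lits C);
  last first.
  rewrite [X in X * _]big1 => [|e _]; last by rewrite noC.
  rewrite mul0r big1 ?subr0 => [|e _]; last by rewrite noC mul0r.
  case: existsP => // -[e /existsP[e' /and3P[+ _ _]]].
  by rewrite noC.
rewrite (sum_lit1 _ _ eC) mul1r (sum_lit _ _ _ eC).
have [e' eC'|noC'] := pickP (fun e : D v => Tagged D e \in clause_lits C');
  last first.
  rewrite big1 => [|e' _]; last by rewrite noC'.
  rewrite noC' subr0; case: existsP => // -[e1 /existsP[e' /and3P[_ + _]]].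
  by rewrite noC'.
rewrite (sum_lit1 _ _ eC').
have -> : (Tagged D e \in clause_lits C') = (e == e').
  by apply/idP/eqP => [/clause_literal_inj/(_ eC') //|->].
case: existsP => [[e1 /existsP[e2 /and3P[e1C e2C' ]]]|noconf].
  rewrite (clause_literal_inj e1C eC) (clause_literal_inj e2C' eC').
  by move/negPf ->; rewrite subr0.
have [|ne] := eqVneq e e'; first by rewrite subrr.
by case: noconf; exists e; apply/existsP; exists e'; rewrite eC eC' ne.
Qed.

Lemma conflict_matrixE (R : comPzRingType) (V : choiceType) (D : V -> finType)
    (F : multi_clause_set D) :
  conflict_matrix R F =
  \sum_(v <- var F) (var_vec R F v *m (var_vec R F v)^T -
    \sum_(e : D v) lit_vec R F e *m (lit_vec R F e)^T).
Proof.
apply/matrixP => i j; rewrite mxE card_conflict_var natr_sum summxE.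
apply: eq_bigr => v _; rewrite conflict_var_indicator !mxE big_ord1 summxE.
rewrite /var_vec !mxE !summxE; congr (_ * _ - _);
  by apply: eq_bigr => e _; rewrite !mxE ?big_ord1 ?mxE.
Qed.

Lemma conflict_matrix_sym (R : comPzRingType) (V : choiceType)
    (D : V -> finType) (F : multi_clause_set D) :
  (conflict_matrix R F)^T = conflict_matrix R F.
Proof.
rewrite conflict_matrixE raddf_sum /=; apply: eq_bigr => v _.
rewrite raddfB /= trmx_mul trmxK; congr (_ - _).
rewrite [LHS]raddf_sum /=; apply: eq_bigr => e _.
by rewrite trmx_mul trmxK.
Qed.

Lemma map_lit_vec_conj (C : numClosedFieldType) (V : choiceType)
    (D : V -> finType) (F : multi_clause_set D) (v : V) (e : D v) :
  map_mx Num.conj (lit_vec C F e) = lit_vec C F e.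
Proof. by apply/matrixP => i j; rewrite !mxE conjC_nat. Qed.

Lemma conflict_form (C : numClosedFieldType) (V : choiceType)
    (D : V -> finType) (F : multi_clause_set D) (x : 'rV[C]_(nclauses F)) :
  (x *m conflict_matrix C F *m x^t*) 0 0 =
  \sum_(v <- var F) (`|(x *m var_vec C F v) 0 0| ^+ 2 -
    \sum_(e : D v) `|(x *m lit_vec C F e) 0 0| ^+ 2).
Proof.
(* For a real [u], the transpose is the conjugate transpose, so the form of [u *m u^T] is a squared
   modulus. *)
have sq (u : 'cV[C]_(nclauses F)) : map_mx Num.conj u = u ->
    (x *m (u *m u^T) *m x^t*) 0 0 = `|(x *m u) 0 0| ^+ 2.
  move=> u_real; rewrite mulmxA -mulmxA.
  rewrite -{2}u_real map_trmx -map_mxM /= -trmx_mul mxE big_ord1 normCK.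
  by rewrite !mxE.
rewrite conflict_matrixE mulmx_sumr mulmx_suml summxE.
apply: eq_bigr => v _; rewrite mulmxBr mulmxBl mulmx_sumr mulmx_suml.
rewrite mxE [X in _ + X]mxE summxE; congr (_ - _).
  rewrite sq // /var_vec raddf_sum /=.
  by apply: eq_bigr => e _; rewrite map_lit_vec_conj.
by apply: eq_bigr => e _; rewrite sq ?map_lit_vec_conj.
Qed.

Lemma map_conflict_matrix (R : rcfType) (V : choiceType) (D : V -> finType)
    (F : multi_clause_set D) :
  map_mx toC (conflict_matrix R F) = conflict_matrix R[i] F.
Proof. by apply/matrixP => i j; rewrite !mxE rmorph_nat. Qed.

(** * Bounding both eigenvalue counts by [rd F] *)

Lemma num_pos_conflict_matrix (R : rcfType) (V : choiceType) (D : V -> finType)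
    (F : multi_clause_set D) :
  (num_pos_eigenvalues (conflict_matrix R F) <= rd F)%N.
Proof.
(* A variable with a single value adds 0 to [rd F], so no condition may be spent on it. *)
pose cs := [seq var_vec R[i] F v | v <- var F & (1 < #|D v|)%N].
rewrite /num_pos_eigenvalues (eq_bigl (fun x => 0 < 1 * x)) => [|x];
  last by rewrite mul1r.
apply: (@leq_trans (size cs)); last first.
  rewrite size_map size_filter -sum1_count big_mkcond /= leq_sum // => v _.
  by case: ifP => // D_gt1; rewrite subn_gt0.
apply: inertia_bound => [|x xcs]; first exact: conflict_matrix_sym.
rewrite rmorph1 mul1r map_conflict_matrix conflict_form.
rewrite big_seq sumr_le0 // => v vF.
have [D_le1|D_gt1] := leqP #|D v| 1; last first.
  rewrite (xcs (var_vec _ F v)) ?map_f ?mem_filter ?D_gt1 //.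
  rewrite mxE normr0 expr0n sub0r oppr_le0.
  by rewrite sumr_ge0 // => e _; rewrite exprn_ge0.
(* With at most one value, the sum over [e] has at most one term, so the two squares agree. *)
rewrite subr_le0 /var_vec; case: (pickP (fun _ : D v => true)) => [e0 _|D0].
  have sumE (G : D v -> R[i]) : \sum_e G e = G e0.
    rewrite (bigD1 e0) //= big_pred0 ?addr0 // => e.
    apply: contraTF D_le1 => e_neq; rewrite -ltnNge.
    by apply/card_gt1P; exists e, e0.
  by rewrite mulmx_sumr summxE !sumE.
by rewrite !big_pred0 // mulmx0 mxE normr0 expr0n.
Qed.

Lemma num_neg_conflict_matrix (R : rcfType) (V : choiceType) (D : V -> finType)
    (F : multi_clause_set D) :
  (num_neg_eigenvalues (conflict_matrix R F) <= rd F)%N.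
Proof.
(* Leaving out the first value of each domain gives [#|D v| - 1] conditions per variable, hence
   [rd F] in all. *)
pose cs := flatten
  [seq [seq lit_vec R[i] F e | e <- behead (enum (D v))] | v <- var F].
rewrite /num_neg_eigenvalues (eq_bigl (fun x => 0 < -1 * x)) => [|x];
  last by rewrite mulN1r oppr_gt0.
have <- : size cs = rd F.
  rewrite size_flatten /shape -map_comp sumnE big_map; apply: eq_bigr => v _ /=.
  by rewrite size_map size_behead -cardE subn1.
apply: inertia_bound => [|x xcs]; first exact: conflict_matrix_sym.
rewrite rmorphN rmorph1 mulN1r map_conflict_matrix conflict_form oppr_le0.
rewrite big_seq sumr_ge0 // => v vF.
have lit0 e : e \in behead (enum (D v)) -> x *m lit_vec R[i] F e = 0.
  by move=> eD; apply: xcs; apply/flatten_mapP; exists v; rewrite ?map_f.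
rewrite /var_vec mulmx_sumr summxE -!big_enum /=.
case: (enum (D v)) lit0 => [|e0 s] /= lit0.
  by rewrite !big_nil normr0 expr0n subrr.
(* Only the term of the omitted value [e0] survives, so the square of the sum equals the sum of the
   squares. *)
have sum_s (G : D v -> R[i]) : (forall e, e \in s -> G e = 0) ->
    \sum_(e <- e0 :: s) G e = G e0.
  by move=> Gs; rewrite big_cons big_seq big1 ?addr0.
by rewrite !sum_s ?subrr // => e /lit0 ->; rewrite mxE ?normr0 ?expr0n.
Qed.

Theorem theorem2p6p4 (R : realType) (V : choiceType) (D : V -> finType)
    (D_gt0 : forall v : V, (0 < #|D v|)%N) (F : multi_clause_set D) :
  (deficiency F <= hermitian_defect R F)%R.
Proof.
rewrite /deficiency /hermitian_defect lerD2l lerN2 lez_nat geq_max.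
by rewrite num_pos_conflict_matrix num_neg_conflict_matrix.
Qed.
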